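(* Let $Q$ be an $n$-dimensional manifold and let $$H_j=\frac12\sum_{i=1}^n g_j^{ii}(\boldsymbol q)\,p_i^2+V_j(\boldsymbol q),\qquad j=1,\ldots,n,$$ be a Stäckel-separable completely integrable Hamiltonian system on $T^*Q$, separable in a coordinate chart $(q^1,\ldots,q^n)$ with associated Stäckel matrix $S^{(n)}(\boldsymbol q)$. Let the contravariant metric and the Stäckel potentials be given, for all $j,k=1,\ldots,n$, by $$g_j^{kk}(\boldsymbol q)=\big[(S^{(n)}(\boldsymbol q))^{-1}\big]_{jk},\qquad V_j(\boldsymbol q)=\sum_{i=1}^n g_j^{ii}(\boldsymbol q)\,W_i(q^i),$$ where $\boldsymbol W=(W_1(q^1),\ldots,W_n(q^n))^T$ is the Stäckel vector. Let $\tilde Q=Q\times\mathbb R$, with coordinate $u=q^{n+1}$ on $\mathbb R$ and conjugate momentum $p_u=p_{n+1}$, and consider the lifting matrix $$\mathcal L^{(n+1)}(\boldsymbol q)=\begin{pmatrix} S^{(n)}(\boldsymbol q) & -\boldsymbol W\\ \boldsymbol 0^T & 1\end{pmatrix}.$$ Then, choosing the Stäckel functions $f_i=\frac12p_i^2$ for $i=1,\ldots,n$ and $f_{n+1}=p_u^2$, the Stäckel lift generated by $\mathcal L^{(n+1)}$, i.e. $(\tilde H_1,\ldots,\tilde H_{n+1})^T=(\mathcal L^{(n+1)})^{-1}(f_1,\ldots,f_{n+1})^T$, yields the independent lifted Hamiltonians on $T^*\tilde Q$ $$\tilde H_j=\frac12\sum_{i=1}^n g_j^{ii}(\boldsymbol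 q)\,p_i^2+V_j(\boldsymbol q)\,p_u^2,\quad j=1,\ldots,n,\qquad \tilde H_{n+1}=p_u^2,$$ making the system completely integrable. In particular, $\tilde H_1$ is the geodesic Hamiltonian of the Riemannian Eisenhart lift of the natural system with metric $g_{ij}$ (the metric with contravariant components $g^{ij}=\mathrm{diag}(g_1^{11},\ldots,g_1^{nn})$) and potential $V_1$ (Riemannian wherever $V_1>0$), while the remaining $\tilde H_j$ are higher Stäckel integrals corresponding to Killing tensors of the same lifted metric.
   Context: All objects are smooth. A Stäckel matrix $S^{(n)}(\boldsymbol q)$ is an invertible $n\times n$ matrix whose $i$-th row depends only on $q^i$: its entries are $S_{ij}=S_{ij}(q^i)$. A Stäckel vector is a column vector whose $i$-th entry $W_i$ depends only on $q^i$. Cotangent bundles carry the canonical symplectic forms $\omega=\sum_{i=1}^n dp_i\wedge dq^i$ on $T^*Q$ and $\tilde\omega=\sum_{i=1}^{n+1}dp_i\wedge dq^i$ on $T^*\tilde Q$. Completely integrable means that the Hamiltonians, equal in number to the dimension of the configuration space, are pairwise in involution and independent; independent means functionally independent on a dense open subset of the phase space. Riemannian Eisenhart lift: for a natural Hamiltonian $H=\frac12\sum_{i,j} g^{ij}(\boldsymbol q)p_ip_j+V(\boldsymbol q)$ on $T^*Q$, it is the Hamiltonian $\frac12\sum_{i,j} g^{ij}(\boldsymbol q)p_ip_j+V(\boldsymbol q)p_u^2$ on $T^*(Q\times\mathbb R)$, homogeneous of degree two in the momenta. It is regarded as the geodesic Hamiltonian $\frac12\sum_{a,b}\tilde g^{ab}p_ap_b$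 of the lifted metric $\tilde g$ on $Q\times\mathbb R$ whose contravariant components are $\tilde g^{ij}=g^{ij}$, $\tilde g^{iu}=0$, $\tilde g^{uu}=2V$. (The name comes from the fact that a positive potential allows one to define a Riemannian metric in the higher-dimensional space.) A function $F=\frac12\sum_{a,b} K^{ab}p_ap_b$, with $K^{ab}$ symmetric and depending on the configuration coordinates, corresponds to the 2-tensor $K^{ab}$; this is a Killing tensor of $\tilde g$ when $F$ Poisson-commutes with the geodesic Hamiltonian of $\tilde g$.
   Formalization: ''Riemannian wherever V_1>0'' is stated at points where the metric g_ij is itself Riemannian, since a Stäckel matrix may give an indefinite g_1 (n=1, S=-1, W=-1 gives V_1=1 but lifted metric diag(-1,2)); everything is stated on the domain of the separable chart. *)

(* Defs.v *)
From HB Require Import structures.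
From mathcomp Require Import all_boot all_order all_algebra.
From mathcomp Require Import all_classical all_reals all_analysis.

Set Implicit Arguments.
Unset Strict Implicit.
Unset Printing Implicit Defensive.

Import Order.TTheory GRing.Theory Num.Theory.
Import numFieldNormedType.Exports.

Local Open Scope classical_set_scope.
Local Open Scope ring_scope.

(* The configuration space is given by the domain U : set 'rV[R]_n of its
   coordinate chart; points of the cotangent bundle are pairs z = (q, p) in
   canonical coordinates.  Fields and functions are total, but only their
   restrictions to U (or to the part of the cotangent bundle above U)
   matter. *)
Notation phase R n := ('rV[R]_n * 'rV[R]_n)%type.

Definition cotangent (R : realType) (n : nat) (U : set 'rV[R]_n) :
  set (phase R n) := [set z | U z.1].

Fixpoint iter_derive (R : realType) (E : normedModType R)
    (vs : seq E) (f : E -> R) : E -> R :=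
  if vs is v :: vs' then fun x => 'D_v (iter_derive vs' f) x else f.

(* C^oo on the open set A (E is always finite-dimensional here): directional
   derivatives of all orders exist and are continuous on A. *)
Definition smooth_on (R : realType) (E : normedModType R)
    (A : set E) (f : E -> R) : Prop :=
  forall (vs : seq E) (x : E), A x ->
    {for x, continuous (iter_derive vs f)} /\
    (forall v : E, derivable (iter_derive vs f) x v).

Definition basis_vec (R : realType) (n : nat) (i : 'I_n) : 'rV[R]_n :=
  delta_mx 0 i.

Definition d_q (R : realType) (n : nat) (i : 'I_n) (F : phase R n -> R)
  (z : phase R n) : R := 'D_((basis_vec R i, 0) : phase R n) F z.

Definition d_p (R : realType) (n : nat) (i : 'I_n) (F : phase R n -> R)
  (z : phase R n) : R := 'D_((0, basis_vec R i) : phase R n) F z.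

(* Bracket of the canonical form \sum_i dp_i /\ dq^i, up to the overall sign,
   which is a matter of convention. *)
Definition poisson (R : realType) (n : nat) (F G : phase R n -> R)
    (z : phase R n) : R :=
  \sum_(i < n) (d_q i F z * d_p i G z - d_p i F z * d_q i G z).

Definition jacobian_mx (R : realType) (m n : nat)
    (F : 'I_m -> phase R n -> R) (z : phase R n) : 'M[R]_(m, n + n) :=
  row_mx (\matrix_(j, i) d_q i (F j) z) (\matrix_(j, i) d_p i (F j) z).

Definition independent_on (R : realType) (m n : nat) (P : set (phase R n))
    (F : 'I_m -> phase R n -> R) : Prop :=
  exists D : set (phase R n),
    [/\ open D, D `<=` P, P `<=` closure D &
        forall z, D z -> row_free (jacobian_mx F z)].

Definition completely_integrable (R : realType) (n : nat)
    (P : set (phase R n)) (F : 'I_n -> phase R n -> R) : Prop :=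
  [/\ forall j, smooth_on P (F j),
      forall j k z, P z -> poisson (F j) (F k) z = 0 &
      independent_on P F].

Definition staeckel_matrix (R : realType) (n : nat) (U : set 'rV[R]_n)
    (S : 'rV[R]_n -> 'M[R]_n) : Prop :=
  [/\ forall i j, smooth_on U (fun q => S q i j),
      forall q, U q -> S q \in unitmx &
      forall i j q q', U q -> U q' -> q 0 i = q' 0 i -> S q i j = S q' i j].

Definition staeckel_vector (R : realType) (n : nat) (U : set 'rV[R]_n)
    (W : 'rV[R]_n -> 'cV[R]_n) : Prop :=
  (forall i, smooth_on U (fun q => W q i 0)) /\
  (forall i q q', U q -> U q' -> q 0 i = q' 0 i -> W q i 0 = W q' i 0).

(* (H_1, ..., H_n)^T = S^-1 (f_1, ..., f_n)^T *)
Definition staeckel_hamiltonian (R : realType) (n : nat)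
    (S : 'rV[R]_n -> 'M[R]_n) (f : phase R n -> 'cV[R]_n)
    (j : 'I_n) (z : phase R n) : R :=
  (invmx (S z.1) *m f z) j 0.

(* The separation relations \sum_j S_ij(q^i) H_j = f_i(q^i, p_i) can be solved
   for the H_j, with each f_i a function of a single canonical pair. *)
Definition staeckel_separable (R : realType) (n : nat) (U : set 'rV[R]_n)
    (S : 'rV[R]_n -> 'M[R]_n) (H : 'I_n -> phase R n -> R) : Prop :=
  staeckel_matrix U S /\
  exists f : 'I_n -> R -> R -> R,
    forall j z, cotangent U z ->
      H j z = staeckel_hamiltonian S
                (fun y => \col_i f i (y.1 0 i) (y.2 0 i)) j z.

(* Coordinates on Q x R are 'rV[R]_(n + 1): the first n are those of Q and the
   last one is u. *)
Definition base_part (R : realType) (n : nat) (x : 'rV[R]_(n + 1)) :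
  'rV[R]_n := lsubmx x.

Definition fibre_part (R : realType) (n : nat) (x : 'rV[R]_(n + 1)) : R :=
  x 0 (rshift n ord0).

Definition lifted_domain (R : realType) (n : nat) (U : set 'rV[R]_n) :
  set 'rV[R]_(n + 1) := [set x | U (base_part x)].

Definition lifting_matrix (R : realType) (n : nat)
    (S : 'rV[R]_n -> 'M[R]_n) (W : 'rV[R]_n -> 'cV[R]_n)
    (x : 'rV[R]_(n + 1)) : 'M[R]_(n + 1) :=
  block_mx (S (base_part x)) (- W (base_part x)) 0 1%:M.

Definition lift_functions (R : realType) (n : nat) (z : phase R (n + 1)) :
    'cV[R]_(n + 1) :=
  col_mx (\col_i (2^-1 * base_part z.2 0 i ^+ 2)) (fibre_part z.2 ^+ 2)%:M.

Definition staeckel_lift (R : realType) (n : nat)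
    (S : 'rV[R]_n -> 'M[R]_n) (W : 'rV[R]_n -> 'cV[R]_n) :
    'I_(n + 1) -> phase R (n + 1) -> R :=
  staeckel_hamiltonian (lifting_matrix S W) (@lift_functions R n).

(* 1/2 \sum_ab K^ab(q) p_a p_b, for contravariant components K^ab; the geodesic
   Hamiltonian when K is a metric. *)
Definition quadratic_hamiltonian (R : realType) (m : nat)
    (K : 'rV[R]_m -> 'M[R]_m) (z : phase R m) : R :=
  2^-1 * \sum_(a < m) \sum_(b < m) K z.1 a b * z.2 0 a * z.2 0 b.

Definition natural_hamiltonian (R : realType) (n : nat)
    (ginv : 'rV[R]_n -> 'M[R]_n) (V : 'rV[R]_n -> R) (z : phase R n) : R :=
  quadratic_hamiltonian ginv z + V z.1.

Definition eisenhart_lift (R : realType) (n : nat)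
    (ginv : 'rV[R]_n -> 'M[R]_n) (V : 'rV[R]_n -> R)
    (z : phase R (n + 1)) : R :=
  quadratic_hamiltonian ginv (base_part z.1, base_part z.2)
  + V (base_part z.1) * fibre_part z.2 ^+ 2.

(* Contravariant components of the lifted metric. *)
Definition eisenhart_metric (R : realType) (n : nat)
    (ginv : 'rV[R]_n -> 'M[R]_n) (V : 'rV[R]_n -> R)
    (x : 'rV[R]_(n + 1)) : 'M[R]_(n + 1) :=
  block_mx (ginv (base_part x)) 0 0 (2 * V (base_part x))%:M.

Definition positive_definite (R : realType) (m : nat) (A : 'M[R]_m) : Prop :=
  A^T = A /\ forall v : 'rV[R]_m, v != 0 -> 0 < (v *m A *m v^T) 0 0.

(* ginv holds the contravariant components at a point: the metric itself is the
   inverse matrix. *)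
Definition riemannian_at (R : realType) (m : nat) (ginv : 'M[R]_m) : Prop :=
  ginv \in unitmx /\ positive_definite (invmx ginv).

(* Killing 2-tensors of the metric with contravariant components G. *)
Definition killing_tensor (R : realType) (m : nat) (A : set 'rV[R]_m)
    (G K : 'rV[R]_m -> 'M[R]_m) : Prop :=
  [/\ forall a b, smooth_on A (fun x => K x a b),
      forall x, A x -> (K x)^T = K x &
      forall z, cotangent A z ->
        poisson (quadratic_hamiltonian K) (quadratic_hamiltonian G) z = 0].

Definition diag_metric (R : realType) (n : nat)
    (g : 'I_n -> 'rV[R]_n -> R) (q : 'rV[R]_n) : 'M[R]_n :=
  diag_mx (\row_i g i q).

(* Main.v *)
Require Import Defs.
From HB Require Import structures.
From mathcomp Require Import all_boot all_order all_algebra.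
From mathcomp Require Import all_classical all_reals all_analysis.

Set Implicit Arguments.
Unset Strict Implicit.
Unset Printing Implicit Defensive.

Import Order.TTheory GRing.Theory Num.Theory.
Import numFieldNormedType.Exports.

Local Open Scope classical_set_scope.
Local Open Scope ring_scope.

(* Each row of the lifting matrix L depends on a single coordinate, so L is
   itself a Staeckel matrix and the lift is an ordinary Staeckel system on the
   extended space.  Differentiating the separation relations L H = f along q^k
   or p_k leaves only the k-th equation, so the gradients of all H_j in the k-th
   canonical pair are the entries (L^-1)_jk times one common vector: every term
   of the bracket {H_j, H_l} vanishes.  In the momentum directions the Jacobian
   is L^-1 diag(df_k/dp_k), which is invertible wherever no momentum vanishes,
   hence on a dense open set.  The Killing tensors are then read off from the
   brackets with H_1. *)

(** * Calculus of smooth functions on an open set *)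

Lemma near_derive_ext (R : realType) (E : normedModType R) (A : set E)
    (f g : E -> R) (x v : E) :
  open A -> {in A, f =1 g} -> A x ->
  'D_v f x = 'D_v g x /\ (derivable f x v -> derivable g x v).
Proof.
move=> oA fg Ax; have fg' : {near x, f =1 g}.
  by near=> y; apply: fg; rewrite inE; near: y; exact: open_nbhs_nbhs.
by split; [exact: near_eq_derive|exact: near_eq_derivable].
Unshelve. all: by end_near. Qed.

Lemma continuous_for_ext (R : realType) (E : normedModType R) (A : set E)
    (f g : E -> R) (x : E) :
  open A -> {in A, f =1 g} -> A x ->
  {for x, continuous f} -> {for x, continuous g}.
Proof.
move=> oA fg Ax; rewrite /prop_for /continuous_at => cf.
rewrite -(fg x (mem_set Ax)); apply: cvg_trans cf; apply: near_eq_cvg.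
by near=> y; apply: fg; rewrite inE; near: y; exact: open_nbhs_nbhs.
Unshelve. all: by end_near. Qed.

(* [smooth_upto k A f] controls the derivatives of order up to [k + 1];
   stripping the innermost derivative rather than the outermost one makes the
   Leibniz rule an induction on [k]. *)
Fixpoint smooth_upto (R : realType) (E : normedModType R) (k : nat)
    (A : set E) (f : E -> R) : Prop :=
  (forall x, A x -> {for x, continuous f} /\ forall v, derivable f x v) /\
  (if k is k'.+1 then forall v, smooth_upto k' A ('D_v f) else True).

Section Smooth.
Variables (R : realType) (E : normedModType R) (A : set E).
Hypothesis oA : open A.
Implicit Types (f g : E -> R) (k : nat).

Lemma iter_derive_rcons vs v f :
  iter_derive (rcons vs v) f = iter_derive vs ('D_v f).
Proof. by elim: vs => //= w vs ->. Qed.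

Lemma smooth_onP f : smooth_on A f <-> forall k, smooth_upto k A f.
Proof.
split=> [sf k|sf vs].
  elim: k f sf => [|k IH] f sf; split=> //=; try exact: (sf [::]).
  by move=> v; apply: IH => vs; rewrite -iter_derive_rcons; exact: sf.
(* The last entry of [vs] is the derivative taken first, which is the one that [smooth_upto] strips;
   hence induction from the right. *)
elim/last_ind: vs f sf => [|vs v IH] f sf.
  exact: (sf 0%N).1.
rewrite iter_derive_rcons; apply: IH => k.
exact: (sf k.+1).2.
Qed.

Lemma smooth_upto0 k f x : smooth_upto k A f -> A x ->
  {for x, continuous f} /\ forall v, derivable f x v.
Proof. by case: k => [|k] [+ _]; exact. Qed.

(** Functions are total but only their values on [A] are controlled. Since [A] is open, equality on
    [A] is equality near each of its points, and so passes to derivatives, again on [A]. *)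
Lemma smooth_upto_ext k f g :
  {in A, f =1 g} -> smooth_upto k A f -> smooth_upto k A g.
Proof.
elim: k f g => [|k IH] f g fg sf; split=> //.
1,2: move=> x Ax; have [cf df] := smooth_upto0 sf Ax;
  split; [exact: (continuous_for_ext oA fg Ax cf)|move=> v];
  by have [_] := near_derive_ext v oA fg Ax; apply; exact: df.
move=> v; apply: IH (sf.2 v) => x; rewrite inE => Ax.
exact: (near_derive_ext v oA fg Ax).1.
Qed.

Lemma smooth_uptoW k f : smooth_upto k.+1 A f -> smooth_upto k A f.
Proof.
elim: k f => [|k IH] f [f0 fS]; split=> // v.
exact/IH/fS.
Qed.

Lemma smooth_uptoD k f g :
  smooth_upto k A f -> smooth_upto k A g -> smooth_upto k A (f + g).
Proof.
elim: k f g => [|k IH] f g sf sg; split=> //.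
1,2: move=> x Ax; have [cf df] := smooth_upto0 sf Ax;
  have [cg dg] := smooth_upto0 sg Ax;
  by split=> [|v]; [exact: cvgD|exact: derivableD].
move=> v; apply: (@smooth_upto_ext _ ('D_v f + 'D_v g)).
  move=> x; rewrite inE => Ax.
  by rewrite deriveD //; [apply: (smooth_upto0 sf Ax).2|
                          apply: (smooth_upto0 sg Ax).2].
by apply: IH; [exact: sf.2|exact: sg.2].
Qed.

(** In each Leibniz term one factor is differentiated; [smooth_uptoW] lowers the other factor to the
    same order, so the induction hypothesis applies to both products. *)
Lemma smooth_uptoM k f g :
  smooth_upto k A f -> smooth_upto k A g -> smooth_upto k A (f * g).
Proof.
elim: k f g => [|k IH] f g sf sg; split=> //.
1,2: move=> x Ax; have [cf df] := smooth_upto0 sf Ax;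
  have [cg dg] := smooth_upto0 sg Ax;
  by split=> [|v]; [exact: cvgM|exact: derivableM].
move=> v; apply: (@smooth_upto_ext _ (f * 'D_v g + g * 'D_v f)).
  move=> x; rewrite inE => Ax.
  by rewrite deriveM //; [apply: (smooth_upto0 sf Ax).2|
                          apply: (smooth_upto0 sg Ax).2].
apply: smooth_uptoD; apply: IH.
- exact: smooth_uptoW.
- exact: sg.2.
- exact: smooth_uptoW.
- exact: sf.2.
Qed.

Lemma smooth_upto_cst k (c : R) : smooth_upto k A (cst c).
Proof.
elim: k c => [|k IH] c; split=> //.
1,2: by move=> x Ax; split=> [|v]; [exact: cvg_cst|exact: derivable_cst].
move=> v; apply: smooth_upto_ext (IH 0) => x _.
by rewrite derive_cst.
Qed.

(** The derivative of [1/f] is [-(1/f)^2] times that of [f]: it involves [1/f] again, but only to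
    one order less. *)
Lemma smooth_uptoV k f : (forall x, A x -> f x != 0) ->
  smooth_upto k A f -> smooth_upto k A (fun x => (f x)^-1).
Proof.
move=> f0; elim: k => [|k IH] sf; split=> //.
1,2: move=> x Ax; have [cf df] := smooth_upto0 sf Ax;
  by split=> [|v]; [apply: cvgV => //; exact: f0|
                    apply: derivableV => //; exact: f0].
move=> v; have sV := IH (smooth_uptoW sf).
apply: (@smooth_upto_ext _
  (cst (-1) * ((fun x => (f x)^-1) * (fun x => (f x)^-1)) * 'D_v f)).
  move=> x; rewrite inE => Ax; rewrite deriveV; last 2 first.
    exact: f0.
    exact: (smooth_upto0 sf Ax).2.
  by rewrite /GRing.scale/= /GRing.mul/= mulN1r -invfM -expr2.
apply: smooth_uptoM; last exact: sf.2.
by apply: smooth_uptoM; [exact: smooth_upto_cst|exact: smooth_uptoM].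
Qed.

Lemma smooth_on_ext f g : {in A, f =1 g} -> smooth_on A f -> smooth_on A g.
Proof.
move=> fg /smooth_onP sf; apply/smooth_onP => k.
exact: smooth_upto_ext (sf k).
Qed.

Lemma smooth_onD f g :
  smooth_on A f -> smooth_on A g -> smooth_on A (fun x => f x + g x).
Proof.
move=> /smooth_onP sf /smooth_onP sg; apply/smooth_onP => k.
by apply: smooth_uptoD.
Qed.

Lemma smooth_onM f g :
  smooth_on A f -> smooth_on A g -> smooth_on A (fun x => f x * g x).
Proof.
move=> /smooth_onP sf /smooth_onP sg; apply/smooth_onP => k.
by apply: smooth_uptoM.
Qed.

Lemma smooth_on_cst (c : R) : smooth_on A (fun=> c).
Proof. by apply/smooth_onP => k; exact: smooth_upto_cst. Qed.

Lemma smooth_onN f : smooth_on A f -> smooth_on A (fun x => - f x).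
Proof.
move=> sf; apply: (@smooth_on_ext (fun x => -1 * f x)).
  by move=> x _; rewrite mulN1r.
exact: smooth_onM (smooth_on_cst (-1)) sf.
Qed.

Lemma smooth_onV f : (forall x, A x -> f x != 0) ->
  smooth_on A f -> smooth_on A (fun x => (f x)^-1).
Proof.
move=> f0 /smooth_onP sf; apply/smooth_onP => k.
exact: smooth_uptoV.
Qed.

Lemma smooth_on_sum (I : Type) (r : seq I) (P : pred I) (F : I -> E -> R) :
  (forall i, smooth_on A (F i)) ->
  smooth_on A (fun x => \sum_(i <- r | P i) F i x).
Proof.
move=> sF; elim: r => [|i r IH].
  by apply: smooth_on_ext (smooth_on_cst 0) => x _; rewrite big_nil.
case: (boolP (P i)) => Pi; last first.
  by apply: smooth_on_ext IH => x _; rewrite big_cons (negbTE Pi).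
apply: smooth_on_ext (smooth_onD (sF i) IH) => x _.
by rewrite big_cons Pi.
Qed.

Lemma smooth_on_prod (I : Type) (r : seq I) (P : pred I) (F : I -> E -> R) :
  (forall i, smooth_on A (F i)) ->
  smooth_on A (fun x => \prod_(i <- r | P i) F i x).
Proof.
move=> sF; elim: r => [|i r IH].
  by apply: smooth_on_ext (smooth_on_cst 1) => x _; rewrite big_nil.
case: (boolP (P i)) => Pi; last first.
  by apply: smooth_on_ext IH => x _; rewrite big_cons (negbTE Pi).
apply: smooth_on_ext (smooth_onM (sF i) IH) => x _.
by rewrite big_cons Pi.
Qed.

Lemma smooth_on_det n (M : E -> 'M[R]_n) :
  (forall i j, smooth_on A (fun x => M x i j)) ->
  smooth_on A (fun x => \det (M x)).
Proof.
move=> sM; apply: smooth_on_sum => s.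
by apply: smooth_onM; [exact: smooth_on_cst|exact: smooth_on_prod].
Qed.

(** By Cramer's rule an entry of the inverse is a cofactor over the determinant, both polynomial in
    the entries of [M]. *)
Lemma smooth_on_invmx n (M : E -> 'M[R]_n) :
  (forall x, A x -> M x \in unitmx) ->
  (forall i j, smooth_on A (fun x => M x i j)) ->
  forall i j, smooth_on A (fun x => invmx (M x) i j).
Proof.
move=> uM sM i j.
apply: (@smooth_on_ext (fun x => (\det (M x))^-1 *
  ((-1) ^+ (j + i) * \det (row' j (col' i (M x)))))).
  by move=> x; rewrite inE => Ax; rewrite /invmx uM // !mxE.
apply: smooth_onM.
  apply: smooth_onV; last exact: smooth_on_det.
  by move=> x /uM; rewrite unitmxE unitfE.
apply: smooth_onM; first exact: smooth_on_cst.
by apply: smooth_on_det => k l; apply: smooth_on_ext (sM _ _) => x _; rewrite !mxE.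
Qed.

End Smooth.

(** * Linear maps, projections and lines *)

Lemma derive_comp_linear (R : realType) (E E' : normedModType R)
    (L : E -> E') (f : E' -> R) (v : E) :
  linear L -> 'D_v (f \o L) = 'D_(L v) f \o L.
Proof.
move=> linL; apply/funext => x; rewrite /derive /=.
by under eq_fun do rewrite linL.
Qed.

Lemma smooth_on_comp_linear (R : realType) (E E' : normedModType R)
    (A : set E') (L : E -> E') (f : E' -> R) :
  linear L -> continuous L -> smooth_on A f ->
  smooth_on (L @^-1` A) (f \o L).
Proof.
move=> linL cL sf vs x Ax.
(* Chain rule at all orders: the difference quotients of [f \o L] along [v] are those of [f] along
   [L v]. *)
have -> : iter_derive vs (f \o L) = iter_derive (map L vs) f \o L.
  by elim: vs => //= v vs ->; rewrite derive_comp_linear.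
have [cf df] := sf (map L vs) (L x) Ax; split.
  exact: (continuous_comp (cL x) cf).
move=> v; have := df (L v); rewrite /derivable /=.
by under [in X in _ -> X]eq_fun do rewrite linL.
Qed.

Lemma derive_linear (R : realType) (E : normedModType R) (L : E -> R)
    (x v : E) : linear L -> derivable L x v /\ 'D_v L x = L v.
Proof.
move=> linL.
have cvgL : h^-1 *: ((L \o shift x) (h *: v) - L x) @[h --> 0^'] --> L v.
  have cstL : (fun=> L v) @ (0 : R)^' --> L v by exact: cvg_cst.
  apply: cvg_trans cstL; apply: near_eq_cvg.
  near=> h; rewrite /= linL addrK scalerA mulVf ?scale1r //.
  by near: h; exact: nbhs_dnbhs_neq.
by split; [apply/cvg_ex; exists (L v)|exact: cvg_lim cvgL].
Unshelve. all: by end_near. Qed.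

Lemma smooth_on_linear (R : realType) (E : normedModType R) (A : set E)
    (L : E -> R) : open A -> linear L -> continuous L -> smooth_on A L.
Proof.
move=> oA linL cL; apply/smooth_onP => -[|k]; split=> //=.
1,2: by move=> x _; split=> [|v]; [exact: cL|have [] := derive_linear x v linL].
move=> v; apply: smooth_upto_ext (smooth_upto_cst _ k (L v)) => // x _.
by have [_ ->] := derive_linear x v linL.
Qed.

Lemma linear_fst (R : realType) (E E' : normedModType R) :
  linear (@fst E E').
Proof. by []. Qed.

Lemma linear_snd_coord (R : realType) n (i : 'I_n) :
  linear (fun z : phase R n => z.2 0 i : R).
Proof. by move=> h v z; rewrite /= !mxE. Qed.

Lemma continuous_snd_coord (R : realType) n (i : 'I_n) :
  continuous (fun z : phase R n => z.2 0 i : R).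
Proof.
move=> z; apply: (@continuous_comp _ _ _ snd (fun p : 'rV[R]_n => p 0 i)).
  exact: cvg_snd.
exact: coord_continuous.
Qed.

Lemma continuous_fst (R : realType) (E E' : normedModType R) :
  continuous (@fst E E').
Proof. by move=> z; exact: cvg_fst. Qed.

Lemma open_cotangent (R : realType) n (A : set 'rV[R]_n) :
  open A -> open (cotangent A).
Proof. by apply: open_comp => z _; exact: continuous_fst. Qed.

Lemma near_line (R : realType) (E : normedModType R) (A : set E) (x v : E) :
  nbhs x A -> \forall h \near (0 : R)^', A (h *: v + x).
Proof.
move=> Ax.
have lx : (h : R) *: v + x @[h --> 0^'] --> x.
  rewrite -[X in _ --> X]add0r -[X in _ --> X + _](scale0r v).
  apply: cvgD; last exact: cvg_cst.
  apply: cvgZr_tmp; exact: nbhs_dnbhs.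
exact: lx.
Qed.

(** Serves the entries of [S], whose independence of a coordinate is given only as equality of
    values at points of the domain. *)
Lemma derive_eq0 (R : realType) (E : normedModType R) (f : E -> R) (x v : E) :
  (\forall h \near (0 : R)^', f (h *: v + x) = f x) -> 'D_v f x = 0.
Proof.
move=> fx; apply: cvg_lim => //.
have cst0 : (fun=> 0) @ (0 : R)^' --> (0 : R) by exact: cvg_cst.
apply: cvg_trans cst0; apply: near_eq_cvg.
by apply: filterS fx => h /= ->; rewrite subrr scaler0.
Qed.

(** * Gradients, involution and independence for a Stäckel system *)

Section StaeckelSystem.
Variables (R : realType) (n : nat) (A : set 'rV[R]_n).
Variables (S : 'rV[R]_n -> 'M[R]_n) (f : phase R n -> 'cV[R]_n).
Hypotheses (oA : open A) (stS : staeckel_matrix A S).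
Hypothesis sf : forall i, smooth_on (cotangent A) (fun z => f z i 0).

Local Notation H := (staeckel_hamiltonian S f).

Lemma smooth_staeckel_hamiltonian j : smooth_on (cotangent A) (H j).
Proof.
have [sS uS _] := stS.
apply: (@smooth_on_ext _ _ _ (open_cotangent oA)
  (fun z => \sum_k invmx (S z.1) j k * f z k 0)).
  by move=> z _; rewrite /staeckel_hamiltonian mxE.
apply: (smooth_on_sum (open_cotangent oA)) => k.
apply: (smooth_onM (open_cotangent oA)); last exact: sf.
have := smooth_on_comp_linear (@linear_fst _ _ 'rV[R]_n)
  (@continuous_fst _ _ _) (smooth_on_invmx oA uS sS j k).
exact.
Qed.

(** The Leibniz rule applied to [S H = f], read as a linear system for the derivatives of the
    Hamiltonians. [S] sees only positions, hence the direction [v.1]. *)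
Lemma derive_separation z v : cotangent A z ->
  S z.1 *m (\col_j 'D_v (H j) z) =
  \col_i ('D_v (fun y => f y i 0) z
          - \sum_j 'D_(v.1) (fun q => S q i j) z.1 * H j z).
Proof.
move=> Az; have [sS uS _] := stS; have oP := open_cotangent oA.
apply/colP => i; rewrite !mxE; apply/esym/eqP; rewrite subr_eq; apply/eqP.
have dS j : derivable (fun y : phase R n => S y.1 i j) z v.
  have := smooth_on_comp_linear (@linear_fst _ _ 'rV[R]_n)
    (@continuous_fst _ _ _) (sS i j).
  by move=> /(_ [::] z Az)[_]; apply.
have dH j : derivable (H j) z v.
  by have [_] := smooth_staeckel_hamiltonian j [::] Az; apply.
(* The separation relation holds on the open set above [A], where [S] is invertible, so both sides
   have the same derivative at [z]. *)
transitivity ('D_v (\sum_j ((fun y : phase R n => S y.1 i j) * H j)) z).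
  apply: (near_derive_ext v oP _ Az).1 => y; rewrite inE => Ay.
  rewrite fct_sumE /=; transitivity ((S y.1 *m (invmx (S y.1) *m f y)) i 0).
    by rewrite mulKVmx //; exact: uS.
  by rewrite mxE; apply: eq_bigr.
rewrite derive_sum; last by move=> j; exact: derivableM.
rewrite -big_split /=; apply: eq_bigr => j _.
by rewrite deriveM // mxE /GRing.scale /= [H j z * _]mulrC; congr (_ + _ * _).
Qed.

Lemma derive_staeckel_matrix i k j q : A q -> k != i ->
  'D_(basis_vec R k) (fun q => S q i j) q = 0.
Proof.
move=> Aq ki; have [_ _ rowS] := stS.
apply: derive_eq0; apply: filterS (near_line (basis_vec R k) (open_nbhs_nbhs (conj oA Aq))) => h Ah.
by apply: rowS => //; rewrite !mxE eqxx eq_sym (negbTE ki) mulr0 add0r.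
Qed.

(** Along [p_k] the matrix [S] does not move, so the right-hand side of [derive_separation] has a
    single nonzero candidate, entry [k], and solving picks out column [k] of the inverse. *)
Lemma d_p_staeckel_hamiltonian j k z : cotangent A z ->
  (forall i, i != k -> d_p k (fun y => f y i 0) z = 0) ->
  d_p k (H j) z = invmx (S z.1) j k * d_p k (fun y => f y k 0) z.
Proof.
move=> Az fk; have [_ uS _] := stS.
have := derive_separation ((0, basis_vec R k) : phase R n) Az.
move=> /(congr1 (mulmx (invmx (S z.1)))); rewrite mulKmx; last exact: uS.
move=> /colP/(_ j); rewrite [LHS]mxE -/(d_p k (H j) z) => ->.
rewrite mxE (bigD1 k) //= big1 ?addr0.
  rewrite mxE big1 ?subr0 // => l _.
  by rewrite derive0 mul0r.
move=> i ik; rewrite mxE big1 ?subr0.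
  by have := fk i ik; rewrite /d_p => ->; rewrite mulr0.
by move=> l _; rewrite derive0 mul0r.
Qed.

Lemma d_q_staeckel_hamiltonian k z : cotangent A z ->
  (forall i, i != k -> d_q k (fun y => f y i 0) z = 0) ->
  exists a, forall j, d_q k (H j) z = invmx (S z.1) j k * a.
Proof.
move=> Az fk; have [_ uS _] := stS.
(* The witness is found by unification: the derivative of [f_k] along [q^k] minus the sum over [l]
   of that of [S_kl] times [H_l]. Being chosen before [j], it is common to all the Hamiltonians. *)
eexists => j.
have := derive_separation ((basis_vec R k, 0) : phase R n) Az.
move=> /(congr1 (mulmx (invmx (S z.1)))); rewrite mulKmx; last exact: uS.
move=> /colP/(_ j); rewrite [LHS]mxE -/(d_q k (H j) z) => ->.
rewrite mxE (bigD1 k) //= big1 ?addr0; first by rewrite mxE.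
move=> i ik; rewrite mxE big1 ?subr0.
  by have := fk i ik; rewrite /d_q => ->; rewrite mulr0.
by move=> l _; rewrite derive_staeckel_matrix ?mul0r // eq_sym.
Qed.

Hypothesis f_sep : forall i k z, cotangent A z -> i != k ->
  d_q k (fun y => f y i 0) z = 0 /\ d_p k (fun y => f y i 0) z = 0.

Lemma poisson_staeckel_hamiltonian j l z : cotangent A z ->
  poisson (H j) (H l) z = 0.
Proof.
move=> Az; apply: big1 => k _.
have fq i : i != k -> d_q k (fun y => f y i 0) z = 0 by case/(f_sep Az).
have fp i : i != k -> d_p k (fun y => f y i 0) z = 0 by case/(f_sep Az).
have [a qE] := d_q_staeckel_hamiltonian Az fq.
rewrite !qE !d_p_staeckel_hamiltonian //.
by rewrite mulrACA [X in _ - X]mulrACA [a * _]mulrC subrr.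
Qed.

Lemma row_free_jacobian_staeckel z : cotangent A z ->
  (forall i, d_p i (fun y => f y i 0) z != 0) ->
  row_free (jacobian_mx H z).
Proof.
move=> Az b0; have [_ uS _] := stS.
set b := \row_i d_p i (fun y => f y i 0) z.
have -> : jacobian_mx H z =
    row_mx (\matrix_(j, i) d_q i (H j) z) (invmx (S z.1) *m diag_mx b).
  congr row_mx; apply/matrixP => j k; rewrite mul_mx_diag !mxE.
  by rewrite d_p_staeckel_hamiltonian // => i /(f_sep Az)[].
have ub : diag_mx b \in unitmx.
  rewrite unitmxE det_diag unitfE; apply/prodf_neq0 => i _.
  by rewrite mxE.
(* The zero block discards the position derivatives, so a right inverse of the Jacobian only has to
   invert its momentum block. *)
apply/row_freeP; exists (col_mx 0 (invmx (diag_mx b) *m S z.1)).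
by rewrite mul_row_col mulmx0 add0r -mulmxA mulKVmx // mulVmx //; exact: uS.
Qed.

End StaeckelSystem.

(** General coefficients [c i] are kept because the lift has 1/2 on the base momenta and 1 on
    [p_u]. *)
Lemma staeckel_quadratic_integrable (R : realType) (n : nat)
    (A : set 'rV[R]_n) (S : 'rV[R]_n -> 'M[R]_n) (c : 'I_n -> R) :
  open A -> staeckel_matrix A S -> (forall i, c i != 0) ->
  completely_integrable (cotangent A)
    (staeckel_hamiltonian S (fun z => \col_i (c i * z.2 0 i ^+ 2))).
Proof.
move=> oA stS c0; have oP := open_cotangent oA.
set f := fun z : phase R n => _.
have fE i : (fun z => f z i 0) =
    cst (c i) * ((fun z : phase R n => z.2 0 i) * (fun z : phase R n => z.2 0 i)).
  by apply/funext => z; rewrite mxE.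
have sf i : smooth_on (cotangent A) (fun z => f z i 0).
  have sp : smooth_on (cotangent A) (fun z : phase R n => z.2 0 i).
    by apply: (smooth_on_linear oP (linear_snd_coord i));
      exact: continuous_snd_coord.
  rewrite fE; apply: (smooth_onM oP (smooth_on_cst oP (c i))).
  exact: (smooth_onM oP sp sp).
have df i z v : 'D_v (fun z => f z i 0) z = 2 * c i * z.2 0 i * v.2 0 i.
  have [dp pE] := derive_linear z v (@linear_snd_coord R n i).
  rewrite fE deriveM; [|exact: derivable_cst|exact: derivableM].
  rewrite derive_cst scaler0 addr0 deriveM // pE.
  rewrite /GRing.scale /= /cst -mulr2n -[_ *+ 2]mulr_natl.
  by rewrite -!mulrA mulrCA.
have f_sep i k z : cotangent A z -> i != k ->
    d_q k (fun y => f y i 0) z = 0 /\ d_p k (fun y => f y i 0) z = 0.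
  by move=> Az ik; rewrite /d_q /d_p !df /= !mxE (negbTE ik) andbF mulr0.
split.
- by move=> j; exact: smooth_staeckel_hamiltonian.
- by move=> j k z; exact: poisson_staeckel_hamiltonian.
(* On the set where no momentum vanishes every [d_p i] of [f_i], that is [2 * c i * p_i], is
   nonzero. *)
exists (cotangent A `&` [set z : phase R n | forall i, z.2 0 i != 0]); split.
- apply: openI => //.
  rewrite openE => z /= z0; rewrite /interior.
  apply: (@filter_forall _ _ (fun i (y : phase R n) => y.2 0 i != 0) (nbhs z)) => i.
  apply: (@continuous_snd_coord R n i z [set t | t != 0]).
  by apply: open_nbhs_nbhs; split; [exact: open_neq|exact: z0].
- by move=> z [].
- move=> z Az B zB.
  (* Density: adding one small [h != 0] to all momenta at once leaves the positions fixed and makes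
     every momentum nonzero. *)
  pose v : phase R n := (0, const_mx 1).
  suff : \forall h \near (0 : R)^',
      ((cotangent A `&` [set y : phase R n | forall i, y.2 0 i != 0]) `&` B) (h *: v + z).
    by move=> /filter_ex [h ABh]; exists (h *: v + z).
  apply: filterI; last exact: near_line.
  apply: filterI; first by apply: near_line; exact: open_nbhs_nbhs.
  apply: (@filter_forall _ _
    (fun i h => (h *: v + z).2 0 i != 0) (dnbhs (0 : R))) => i.
  near=> h.
  rewrite /= !mxE mulr1 addr_eq0; near: h.
  (* The value to avoid is [h = - p_i]. If it is 0, the punctured neighbourhood excludes it;
     otherwise it stays away from 0. *)
  have [->|pi0] := eqVneq (z.2 0 i) 0; first by rewrite oppr0; exact: nbhs_dnbhs_neq.
  apply: nbhs_dnbhs; apply: open_nbhs_nbhs; split; first exact: open_neq.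
  by rewrite /= eq_sym oppr_eq0.
- move=> z [Az z0]; apply: (row_free_jacobian_staeckel oA stS sf f_sep Az) => i.
  by rewrite /d_p df /= !mxE !eqxx /= mulr1 !mulf_neq0.
Unshelve. all: by end_near. Qed.

(** * The lifting matrix and the lifted Hamiltonians *)

Lemma linear_base_part (R : realType) n : linear (@base_part R n).
Proof. by move=> h v x; rewrite /base_part linearP. Qed.

Lemma continuous_base_part (R : realType) n : continuous (@base_part R n).
Proof.
move=> x B [P xP PB].
(* Neighbourhoods of row vectors are entrywise boxes; the given box is extended by the whole line in
   the [u] coordinate. *)
pose Q (i : 'I_1) (k : 'I_(n + 1)) : set R :=
  match fintype.split k with inl j => P i j | inr _ => setT end.
exists Q.
  move=> i k; rewrite /Q; case: splitP => // j kj; last exact: filterT.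
  have -> : k = lshift 1 j by exact: val_inj.
  by have := xP i j; rewrite mxE.
move=> y /= Qy; apply: PB => i j; have := Qy i (lshift 1 j).
by rewrite /Q (unsplitK (inl j : 'I_n + 'I_1)) mxE.
Qed.

Section LiftingMatrix.
Variables (R : realType) (n : nat) (U : set 'rV[R]_n).
Variables (S : 'rV[R]_n -> 'M[R]_n) (W : 'rV[R]_n -> 'cV[R]_n).

Lemma open_lifted_domain : open U -> open (lifted_domain U).
Proof. by apply: open_comp => x _; exact: continuous_base_part. Qed.

Lemma smooth_on_base_part f : smooth_on U f ->
  smooth_on (lifted_domain U) (fun x => f (base_part x)).
Proof.
exact: (smooth_on_comp_linear (@linear_base_part R n) (@continuous_base_part R n)).
Qed.

Lemma lifting_matrix_unitmx x :
  (S (base_part x) \in unitmx) -> lifting_matrix S W x \in unitmx.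
Proof. by rewrite !unitmxE det_ublock det1 mulr1. Qed.

(** Row [lshift 1 k] joins row [k] of [S] to [-W_k], both functions of [q^k]; the last row is
    constant. *)
Lemma staeckel_lifting_matrix : open U ->
  staeckel_matrix U S -> staeckel_vector U W ->
  staeckel_matrix (lifted_domain U) (lifting_matrix S W).
Proof.
move=> oU [sS uS rS] [sW rW]; have oL := open_lifted_domain oU.
have coord (q q' : 'rV[R]_(n + 1)) (i : 'I_n) : q 0 (lshift 1 i) = q' 0 (lshift 1 i) ->
    base_part q 0 i = base_part q' 0 i :> R by rewrite !mxE.
split=> [i j|x Ux|i j q q' Uq Uq' qq'].
- case: (split_ordP i) => k ->; case: (split_ordP j) => l ->.
  + apply: (smooth_on_ext oL _ (smooth_on_base_part (sS k l))) => x _.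
    by rewrite /lifting_matrix block_mxEul.
  + apply: (smooth_on_ext oL _ (smooth_onN oL (smooth_on_base_part (sW k)))) => x _.
    by rewrite /lifting_matrix block_mxEur mxE ord1.
  + apply: (smooth_on_ext oL _ (smooth_on_cst oL 0)) => x _.
    by rewrite /lifting_matrix block_mxEdl mxE.
  + apply: (smooth_on_ext oL _ (smooth_on_cst oL (k == l)%:R)) => x _.
    by rewrite /lifting_matrix block_mxEdr mxE.
- exact/lifting_matrix_unitmx/uS.
- move: qq'; rewrite /lifting_matrix.
  case: (split_ordP i) => k ->; case: (split_ordP j) => l -> qq'.
  + by rewrite !block_mxEul; apply: rS => //; exact: coord.
  + by rewrite !block_mxEur !mxE ord1; congr (- _); apply: rW => //; exact: coord.
  + by rewrite !block_mxEdl.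
  + by rewrite !block_mxEdr.
Qed.

Lemma staeckel_liftE z : S (base_part z.1) \in unitmx ->
  \col_j staeckel_lift S W j z =
  col_mx (invmx (S (base_part z.1)) *m
           (\col_i (2^-1 * base_part z.2 0 i ^+ 2)
            + fibre_part z.2 ^+ 2 *: W (base_part z.1)))
         (fibre_part z.2 ^+ 2)%:M.
Proof.
move=> uS; set y := col_mx _ _.
have -> : \col_j staeckel_lift S W j z
    = invmx (lifting_matrix S W z.1) *m lift_functions z.
  by apply/colP => j; rewrite mxE.
(* The vector [y] comes from back substitution: the last row gives [p_u^2], the others then read
   [S H = f + p_u^2 W]. Multiplying back by the lifting matrix avoids computing its inverse. *)
have -> : lift_functions z = lifting_matrix S W z.1 *m y.
  rewrite mul_block_col mulKVmx // mul0mx add0r mul1mx mulNmx.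
  by rewrite mul_mx_scalar addrK.
by rewrite mulKmx //; exact: lifting_matrix_unitmx.
Qed.

End LiftingMatrix.

Lemma lift_functionsE (R : realType) n :
  @lift_functions R n = fun z => \col_i
    (col_mx (\col_(_ < n) 2^-1) (1%:M : 'cV[R]_1) i 0 * z.2 0 i ^+ 2).
Proof.
apply/funext => z; apply/colP => i; rewrite [RHS]mxE /lift_functions.
case: (split_ordP i) => k ->.
  by rewrite !col_mxEu !mxE.
by rewrite !col_mxEd !mxE !ord1 eqxx mulr1n mul1r.
Qed.

(** * Quadratic Hamiltonians and the lifted metric *)

Lemma quadratic_hamiltonian_diag (R : realType) m (d : 'rV[R]_m -> 'rV[R]_m) z :
  quadratic_hamiltonian (fun q => diag_mx (d q)) z =
  2^-1 * \sum_i d z.1 0 i * z.2 0 i ^+ 2.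
Proof.
congr (_ * _); apply: eq_bigr => a _; rewrite (bigD1 a) //= big1 ?addr0.
  by rewrite mxE eqxx mulr1n expr2 mulrA.
by move=> b ba; rewrite mxE eq_sym (negbTE ba) mulr0n !mul0r.
Qed.

Lemma quadratic_hamiltonian_block (R : realType) n
    (A : 'rV[R]_(n + 1) -> 'M[R]_n) (b : 'rV[R]_(n + 1) -> R) z :
  quadratic_hamiltonian (fun x => block_mx (A x) 0 0 (b x)%:M) z =
  quadratic_hamiltonian (fun=> A z.1) (base_part z.1, base_part z.2)
  + 2^-1 * b z.1 * fibre_part z.2 ^+ 2.
Proof.
rewrite /quadratic_hamiltonian -mulrA -mulrDr; congr (_ * _).
rewrite big_split_ord /= big_ord1; congr (_ + _).
  apply: eq_bigr => a _; rewrite big_split_ord /= big_ord1.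
  rewrite block_mxEur mxE !mul0r addr0; apply: eq_bigr => c _.
  by rewrite block_mxEul !mxE.
rewrite big_split_ord /= big_ord1 block_mxEdr mxE eqxx mulr1n big1 ?add0r.
  by rewrite expr2 mulrA.
by move=> c _; rewrite block_mxEdl mxE !mul0r.
Qed.

(** Needed because the lifted Hamiltonians agree with quadratic forms only above the chart
    domain. *)
Lemma poisson_ext (R : realType) n (P : set (phase R n))
    (F F' G G' : phase R n -> R) z :
  open P -> {in P, F =1 F'} -> {in P, G =1 G'} -> P z ->
  poisson F G z = poisson F' G' z.
Proof.
move=> oP FF' GG' Pz; apply: eq_bigr => i _; rewrite /d_q /d_p.
have FE v := (near_derive_ext v oP FF' Pz).1.
have GE v := (near_derive_ext v oP GG' Pz).1.
by rewrite !FE !GE.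
Qed.

Lemma riemannian_block (R : realType) n (A : 'M[R]_n) (b : R) :
  riemannian_at A -> 0 < b -> riemannian_at (block_mx A 0 0 (b%:M : 'M[R]_1)).
Proof.
move=> [uA [symA posA]] b0.
have uB : block_mx A 0 0 (b%:M : 'M[R]_1) \in unitmx.
  by rewrite unitmxE det_ublock unitrM -!unitmxE uA unitmxE det_scalar1 unitfE gt_eqF.
split=> //; rewrite invmx_block_diag // invmx_scalar.
split; first by rewrite tr_block_mx symA !trmx0 tr_scalar_mx.
move=> v v0; rewrite -[v]hsubmxK.
set l := lsubmx v; set r := rsubmx v.
rewrite tr_row_mx mul_row_block !mulmx0 addr0 add0r mul_row_col mxE.
have rE : (r *m (b^-1)%:M *m r^T) 0 0 = b^-1 * r 0 0 ^+ 2.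
  by rewrite mul_mx_scalar -scalemxAl mxE mxE big_ord1 [r^T _ _]mxE expr2.
rewrite rE; have bV : 0 < b^-1 by rewrite invr_gt0.
(* The covariant metric is block diagonal with blocks the inverse of [A] and [1/b]. A nonzero vector
   has either a nonzero base part, where the first block is positive, or a nonzero fibre part, where
   [1/b] is. *)
have [l0|l0] := eqVneq l 0.
  rewrite l0 !mul0mx mxE add0r mulr_gt0 // exprn_even_gt0 //=.
  apply: contra_neq v0 => r0; rewrite -[v]hsubmxK -/l -/r l0.
  suff -> : r = 0 by rewrite row_mx0.
  by apply/matrixP => i k; rewrite !ord1 r0 mxE.
by apply: ltr_wpDr; [rewrite mulr_ge0 ?sqr_ge0 // ltW|exact: posA].
Qed.

(** The factor 2 in the [uu] component cancels the 1/2 of the quadratic form. *)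
Lemma quadratic_eisenhart_metric (R : realType) n
    (G : 'rV[R]_n -> 'M[R]_n) (V : 'rV[R]_n -> R) z :
  quadratic_hamiltonian (eisenhart_metric G V) z = eisenhart_lift G V z.
Proof.
rewrite /eisenhart_lift.
have -> : quadratic_hamiltonian G (base_part z.1, base_part z.2) =
    quadratic_hamiltonian (fun=> G (base_part z.1)) (base_part z.1, base_part z.2).
  by [].
by rewrite quadratic_hamiltonian_block (mulrA 2^-1 2) mulVf ?mul1r ?pnatr_eq0.
Qed.

Lemma smooth_eisenhart_metric (R : realType) n (U : set 'rV[R]_n)
    (G : 'rV[R]_n -> 'M[R]_n) (V : 'rV[R]_n -> R) : open U ->
  (forall i j, smooth_on U (fun q => G q i j)) -> smooth_on U V ->
  forall a b, smooth_on (lifted_domain U) (fun x => eisenhart_metric G V x a b).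
Proof.
move=> oU sG sV a b; have oL := open_lifted_domain oU.
case: (split_ordP a) => k ->; case: (split_ordP b) => l ->.
- apply: (smooth_on_ext oL _ (smooth_on_base_part (sG k l))) => x _.
  by rewrite /eisenhart_metric block_mxEul.
- apply: (smooth_on_ext oL _ (smooth_on_cst oL 0)) => x _.
  by rewrite /eisenhart_metric block_mxEur mxE.
- apply: (smooth_on_ext oL _ (smooth_on_cst oL 0)) => x _.
  by rewrite /eisenhart_metric block_mxEdl mxE.
- apply: (smooth_on_ext oL _
    (smooth_onM oL (smooth_on_cst oL 2) (smooth_on_base_part sV))) => x _.
  by rewrite /eisenhart_metric block_mxEdr mxE !ord1 eqxx mulr1n.
Qed.

Lemma eisenhart_metric_tr (R : realType) n
    (G : 'rV[R]_n -> 'M[R]_n) (V : 'rV[R]_n -> R) x :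
  (G (base_part x))^T = G (base_part x) ->
  (eisenhart_metric G V x)^T = eisenhart_metric G V x.
Proof.
by move=> symG; rewrite /eisenhart_metric tr_block_mx symG !trmx0 tr_scalar_mx.
Qed.

(* [g j k q] is g_j^{kk}(q); [Ordinal n_gt0] is the index of H_1;
   [lshift 1 j], for j < n, and [rshift n ord0] are the lifted indices. *)
Theorem theorem1 (R : realType) (n : nat) (n_gt0 : (0 < n)%N)
    (U : set 'rV[R]_n) (U_open : open U)
    (S : 'rV[R]_n -> 'M[R]_n) (W : 'rV[R]_n -> 'cV[R]_n)
    (g : 'I_n -> 'I_n -> 'rV[R]_n -> R) (V : 'I_n -> 'rV[R]_n -> R)
    (H : 'I_n -> phase R n -> R)
    (S_staeckel : staeckel_matrix U S)
    (W_staeckel : staeckel_vector U W)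
    (gE : forall (j k : 'I_n) (q : 'rV[R]_n), U q ->
       g j k q = invmx (S q) j k)
    (VE : forall (j : 'I_n) (q : 'rV[R]_n), U q ->
       V j q = \sum_(i < n) g j i q * W q i 0)
    (HE : forall (j : 'I_n) (z : phase R n), cotangent U z ->
       H j z = 2^-1 * (\sum_(i < n) g j i z.1 * z.2 0 i ^+ 2) + V j z.1)
    (H_separable : staeckel_separable U S H)
    (H_integrable : completely_integrable (cotangent U) H) :
  let j1 : 'I_n := Ordinal n_gt0 in
  let Ul := lifted_domain U in
  let Ht := staeckel_lift S W in
  let g1 := diag_metric (g j1) in
  let gt := eisenhart_metric g1 (V j1) in
  [/\ forall x, Ul x -> lifting_matrix S W x \in unitmx,
      forall (j : 'I_n) (z : phase R (n + 1)), cotangent Ul z ->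
        Ht (lshift 1 j) z =
          2^-1 * (\sum_(i < n)
                    g j i (base_part z.1) * base_part z.2 0 i ^+ 2)
          + V j (base_part z.1) * fibre_part z.2 ^+ 2,
      forall z : phase R (n + 1), cotangent Ul z ->
        Ht (rshift n ord0) z = fibre_part z.2 ^+ 2,
      completely_integrable (cotangent Ul) Ht &
      [/\ forall z, cotangent U z ->
            H j1 z = natural_hamiltonian g1 (V j1) z,
          forall z, cotangent Ul z ->
            Ht (lshift 1 j1) z = eisenhart_lift g1 (V j1) z /\
            Ht (lshift 1 j1) z = quadratic_hamiltonian gt z,
          forall x, Ul x -> riemannian_at (g1 (base_part x)) ->
            0 < V j1 (base_part x) -> riemannian_at (gt x) &
          forall j : 'I_(n + 1), j != lshift 1 j1 ->
            exists K : 'rV[R]_(n + 1) -> 'M[R]_(n + 1),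
              killing_tensor Ul gt K /\
              forall z, cotangent Ul z -> Ht j z = quadratic_hamiltonian K z]].
Proof.
move=> j1 Ul Ht g1 gt; have [sS uS _] := S_staeckel; have [sW _] := W_staeckel.
have oL : open Ul by exact: open_lifted_domain.
have oP := open_cotangent oL.
have HtE j z : cotangent Ul z -> Ht (lshift 1 j) z =
    2^-1 * (\sum_(i < n) g j i (base_part z.1) * base_part z.2 0 i ^+ 2)
    + V j (base_part z.1) * fibre_part z.2 ^+ 2.
  move=> Uz; rewrite /Ht; have /colP/(_ (lshift 1 j)) := staeckel_liftE W (uS _ Uz).
  rewrite mxE col_mxEu mulmxDr -scalemxAr => ->; rewrite mxE.
  congr (_ + _); rewrite mxE.
    rewrite mulr_sumr; apply: eq_bigr => i _.
    by rewrite mxE gE // mulrCA.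
  by rewrite mulrC mxE VE //; congr (_ * _); apply: eq_bigr => i _; rewrite gE.
have HtuE z : cotangent Ul z -> Ht (rshift n ord0) z = fibre_part z.2 ^+ 2.
  move=> Uz; rewrite /Ht; have /colP/(_ (rshift n ord0)) := staeckel_liftE W (uS _ Uz).
  by rewrite mxE col_mxEd mxE eqxx mulr1n => ->.
(* Every lifted Hamiltonian, not only the first, has the shape of an Eisenhart lift, with its own
   [g j] and [V j]; this supplies the candidate Killing tensors. *)
have quadE j z : cotangent Ul z -> Ht (lshift 1 j) z =
    quadratic_hamiltonian (eisenhart_metric (diag_metric (g j)) (V j)) z.
  move=> Uz; rewrite HtE // quadratic_eisenhart_metric; congr (_ + _).
  rewrite quadratic_hamiltonian_diag; congr (_ * _).
  by apply: eq_bigr => i _; rewrite mxE.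
have integrable : completely_integrable (cotangent Ul) Ht.
  rewrite /Ht /staeckel_lift lift_functionsE.
  apply: (staeckel_quadratic_integrable oL).
    exact: staeckel_lifting_matrix.
  move=> i; case: (split_ordP i) => k ->.
    by rewrite col_mxEu mxE invr_eq0 pnatr_eq0.
  by rewrite col_mxEd !ord1 mxE eqxx oner_eq0.
have sg j k : smooth_on U (g j k).
  apply: (smooth_on_ext U_open _ (smooth_on_invmx U_open uS sS j k)) => q.
  by rewrite inE => Uq; rewrite gE.
have sV j : smooth_on U (V j).
  apply: (smooth_on_ext U_open _ (smooth_on_sum U_open _ _
    (fun i => smooth_onM U_open (sg j i) (sW i)))) => q.
  by rewrite inE => Uq; rewrite VE.
have sdiag j k l : smooth_on U (fun q => diag_metric (g j) q k l).
  apply: (smooth_on_ext U_open _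
    (smooth_onM U_open (sg j k) (smooth_on_cst U_open (k == l)%:R))) => q _.
  by rewrite !mxE mulr_natr.
(* For a tensor of this shape the Killing equation is the involution of [Ht j] with the first
   Hamiltonian, the geodesic one of [gt]. *)
have killing (j : 'I_(n + 1)) (G : 'rV[R]_n -> 'M[R]_n) (X : 'rV[R]_n -> R) : (forall k l, smooth_on U (fun q => G q k l)) ->
    smooth_on U X -> (forall q, (G q)^T = G q) ->
    (forall z, cotangent Ul z ->
       Ht j z = quadratic_hamiltonian (eisenhart_metric G X) z) ->
    exists K : 'rV[R]_(n + 1) -> 'M[R]_(n + 1),
      killing_tensor Ul gt K /\
      forall z, cotangent Ul z -> Ht j z = quadratic_hamiltonian K z.
  move=> sG sX symG jE; exists (eisenhart_metric G X); split=> //; split.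
  - exact: smooth_eisenhart_metric.
  - by move=> x _; exact: eisenhart_metric_tr.
  - move=> z Uz; have [_ inv _] := integrable.
    rewrite -(inv j (lshift 1 j1) z Uz).
    by apply: (poisson_ext oP) => // y; rewrite inE => Uy; [rewrite jE|rewrite quadE].
split=> //; first by move=> x Ux; exact/lifting_matrix_unitmx/uS.
split.
- move=> z Uz; rewrite HE //; congr (_ + _).
  rewrite quadratic_hamiltonian_diag; congr (_ * _).
  by apply: eq_bigr => i _; rewrite mxE.
- by move=> z Uz; rewrite -quadratic_eisenhart_metric quadE.
- by move=> x Ux rg V0; apply: riemannian_block => //; rewrite mulr_gt0.
- move=> j _; case: (split_ordP j) => k ->.
    apply: killing (sdiag k) (sV k) _ (quadE k) => q.
    exact: tr_diag_mx.
  (* The integral [p_u^2] is the lift of zero metric and unit potential: its tensor has the single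
     nonzero entry 2, at [uu]. *)
  rewrite ord1; apply: (killing _ (fun=> 0) (fun=> 1)).
  + by move=> i l; apply: (smooth_on_ext U_open _ (smooth_on_cst U_open 0)) => q _;
      rewrite mxE.
  + exact: smooth_on_cst.
  + by move=> q; rewrite trmx0.
  + move=> z Uz; rewrite HtuE // quadratic_eisenhart_metric /eisenhart_lift mul1r.
    rewrite /quadratic_hamiltonian big1 ?mulr0 ?add0r // => a _.
    by apply: big1 => b _; rewrite mxE !mul0r.
Qed.
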